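(* Let $\ell$ be an odd prime, let $\gamma=\begin{pmatrix} 1 & 0 \\ 0 & -1 \end{pmatrix}$, and let $\delta$ be a generator for $C_{ns}(\ell)$. For each subgroup $H\subseteq C_{ns}(\ell)$ not contained in $Z(\ell)$, the group $G_1=\langle H,\gamma\rangle\subseteq C_{ns}^+(\ell)$ has dihedral image in $\mathrm{PGL}_2(\mathbf{Z}/\ell\mathbf{Z})$ and satisfies $H=G_1\cap C_{ns}(\ell)$ with $\det(H)=-\det(G_1-H)$. If $H$ satisfies $\det(H)=\det(H\cap Z(\ell))$ and $-1\in H$, then for $e:=[Z(\ell):H\cap Z(\ell)]$, the group $G_2:=\langle H,\gamma\delta^e\rangle\subseteq C_{ns}^+(\ell)$ has dihedral image in $\mathrm{PGL}_2(\mathbf{Z}/\ell\mathbf{Z})$ and satisfies $H=G_2\cap C_{ns}(\ell)$ with $\det(H)$ and $-\det(G_2-H)$ disjoint. Up to conjugacy in $\mathrm{GL}_2(\mathbf{Z}/\ell\mathbf{Z})$, this accounts for all subgroups $G$ that lie in the normalizer of a non-split Cartan group and have dihedral image in $\mathrm{PGL}_2(\mathbf{Z}/\ell\mathbf{Z})$. The number of such $G$ (up to conjugacy in $\mathrm{GL}_2(\mathbf{Z}/\ell\mathbf{Z})$) is \[\tau(\ell^2-1)-\tau(\ell-1)+\tau\left(\frac{\ell^2-1}{4}\right)-\tau\left(\frac{\ell-1}{2}\right).\]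
   Context: Fix a non-square $\varepsilon\in(\mathbf{Z}/\ell\mathbf{Z})^\times$. Then $C_{ns}(\ell):=\left\{\begin{pmatrix} x & \varepsilon y \\ y & x \end{pmatrix}:(x,y)\ne(0,0)\right\}\subseteq\mathrm{GL}_2(\mathbf{Z}/\ell\mathbf{Z})$, a cyclic group of order $\ell^2-1$, and $C_{ns}^+(\ell):=C_{ns}(\ell)\cup\gamma C_{ns}(\ell)$ is its normalizer. Non-split Cartan groups are the conjugates of $C_{ns}(\ell)$ in $\mathrm{GL}_2(\mathbf{Z}/\ell\mathbf{Z})$. $Z(\ell)$ is the group of scalar matrices in $\mathrm{GL}_2(\mathbf{Z}/\ell\mathbf{Z})$ and $-1$ denotes the scalar matrix $-I$. For subsets $T$ of $\mathrm{GL}_2(\mathbf{Z}/\ell\mathbf{Z})$, $\det(T)$ is the set of determinants and $-\det(T):=\{-\det g:g\in T\}$; $G-H$ denotes set difference. $\tau(n)$ is the number of positive divisors of $n$. The non-cyclic group of order $4$ (Klein group) is considered to be dihedral. *)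

(* Defs.v *)
From mathcomp Require Import all_boot all_order all_algebra all_fingroup.
From mathcomp Require Import all_solvable.

Set Implicit Arguments.
Unset Strict Implicit.
Unset Printing Implicit Defensive.

Import GRing.Theory.

Local Open Scope ring_scope.

Definition tau (n : nat) : nat := size (divisors n).

Definition mx22 (R : Type) (a b c d : R) : 'M[R]_2 :=
  \matrix_(i < 2, j < 2)
    if i == 0 then (if j == 0 then a else b) else (if j == 0 then c else d).

(* Isomorphic to a dihedral group of order 2n with n >= 2; 'D_4 is the Klein
   group.  The library's 'D_m is meaningful only for even m >= 4, hence the
   conditions on the order. *)
Definition is_dihedral (gT : finGroupType) (A : {set gT}) : bool :=
  [&& (3 < #|A|)%N, ~~ odd #|A| & A \isog 'D_#|A| ].

Lemma mx22_gamma_unit (R : comUnitRingType) :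
  mx22 1 0 0 (-1) \is a @GRing.unit ('M[R]_2).
Proof.
suff E : mx22 1 0 0 (-1) * mx22 1 0 0 (-1) = 1 :> 'M[R]_2.
  by apply/unitrP; exists (mx22 1 0 0 (-1)).
apply/matrixP=> i j; rewrite !mxE !big_ord_recl big_ord0 !mxE /=.
case: i => [[|[|i]]] // Hi; case: j => [[|[|j]]] // Hj;
by rewrite /= ?(mulr1, mul1r, mulr0, mul0r, addr0, add0r, mulrNN).
Qed.

(* Z/ell is 'F_ell, which is the intended ring only for ell prime. *)
Section GL2.

Variable ell : nat.
Local Notation GL2 := {'GL_2['F_ell]}.

Definition gammaGL : GL2 := FinRing.unit _ (mx22_gamma_unit 'F_ell).

Definition minus1 : GL2 := FinRing.unit _ (unitrN1 ('M['F_ell]_2)).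

Definition scalarGL : {set GL2} := [set g : GL2 | is_scalar_mx (GLval g)].

Lemma scalarGL_group_set : group_set scalarGL.
Proof.
apply/group_setP; split=> [|g h]; first by rewrite inE; apply: scalar_mx_is_scalar.
rewrite !inE => /is_scalar_mxP[a ga] /is_scalar_mxP[b hb].
by apply/is_scalar_mxP; exists (a * b); rewrite GL_MxE ga hb -scalar_mxM.
Qed.
Canonical scalarGL_group := Group scalarGL_group_set.

(* The image of A in PGL_2 = GL_2 / Z. *)
Definition imPGL (A : {set GL2}) : {set coset_of scalarGL} :=
  (A / scalarGL)%g.

Definition detset (A : {set GL2}) : {set 'F_ell} :=
  [set \det (GLval g) | g in A].

Definition opp_detset (A : {set GL2}) : {set 'F_ell} :=
  [set - \det (GLval g) | g in A].

(* For eps a non-square the condition (x, y) != (0, 0) already makes the matrix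
   invertible, so restricting to elements of GL_2 loses nothing. *)
Definition Cns (eps : 'F_ell) : {set GL2} :=
  [set g : GL2 | [exists x : 'F_ell, [exists y : 'F_ell,
     ((x, y) != (0, 0)) && ((GLval g : 'M['F_ell]_2) == mx22 x (eps * y) y x)]]].

Definition Cns_plus (eps : 'F_ell) : {set GL2} :=
  (Cns eps :|: gammaGL *: Cns eps)%g.

Definition nonsplit_Cartan (eps : 'F_ell) (C : {set GL2}) : bool :=
  [exists g : GL2, C == (Cns eps :^ g)%g].

Definition G1 (H : {set GL2}) : {set GL2} := <<gammaGL |: H>>%g.

Definition G2 (delta : GL2) (H : {set GL2}) : {set GL2} :=
  let e := #|scalarGL : H :&: scalarGL|%g in
  <<(gammaGL * delta ^+ e)%g |: H>>%g.

Definition dihedral_nonsplit (eps : 'F_ell) : {set {group GL2}} :=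
  [set G : {group GL2} |
     [exists C : {set GL2}, nonsplit_Cartan eps C && (G \subset 'N(C))%g]
     && is_dihedral (imPGL G)].

(* The set of GL_2-conjugacy classes of the groups in S. *)
Definition conj_classes (S : {set {group GL2}}) : {set {set {set GL2}}} :=
  [set (G :^: [set: GL2])%g | G : {group GL2} in S].

End GL2.

(* Main.v *)
Require Import Defs.
From mathcomp Require Import all_boot all_order all_algebra all_fingroup.
From mathcomp Require Import all_solvable all_field.
From mathcomp Require Import ring.

(** The non-split Cartan group C is the multiplicative group of the field with
    ell^2 elements, Z is that of the prime field, and gamma acts on C as the
    Frobenius automorphism c |-> c^ell ([Cns_pow]).  Almost everything is a
    formal consequence of this, so the classification is proved for an abstract
    finite group containing a cyclic group C of order (q - 1)(q + 1), its
    subgroup Z of order q - 1, and an involution g with c^g = c^q on C.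

    A subgroup G of C :|: g C that is not inside C is generated by H = G :&: C
    and one element g c, whose square is the norm c^(q+1); so this norm lies in
    A = H :&: Z.  Modulo Z, g c inverts C, which makes the image of G dihedral as
    soon as H is not in Z ([twist_gen_dihedral]).  Conjugating g c by elements
    of C multiplies c by (q-1)-st powers, which are the elements of norm 1
    ([pow_q1_fibre]); hence, for H fixed, the class of G only depends on the
    norm of c modulo the norms of H ([twist_gen_conj]).  The norms of H contain
    the squares of A, which have index at most 2 in the cyclic group A.
    So there is one class, that of <<g, H>>, plus a second one exactly when the
    norms of H are the squares of A and differ from A ([norm_index2]); the
    second one is represented by c = d^e, as the norm of d^e generates A.
    The norm of an element of C determines and is determined by its
    determinant, which turns this into the stated conditions on det.

    Comparing orders, a subgroup H of order n has the second class iff n is even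
    and 2n divides q^2 - 1 ([mem_norms_card]), and H is in Z iff n divides q - 1.
    As C has one subgroup for each divisor of q^2 - 1, the number of classes is
    a count of divisors.  The classes so listed are distinct: the order of G
    gives n, and the two classes attached to one H have different sets of
    determinants ([ext1_ext2_not_conj]).

    For GL_2 itself three facts remain to be checked by matrix computations: the
    order of C, the Frobenius action, and that C :|: gamma C contains the
    normalizer of C ([Cns_norm_sub]). *)

Set Implicit Arguments.
Unset Strict Implicit.
Unset Printing Implicit Defensive.

(** * Cyclic and dihedral groups *)

Section IndexTwo.
Local Open Scope group_scope.
Variable gT : finGroupType.
Implicit Types (H K G C Z : {group gT}) (x y : gT).

(** The right-hand side is closed under products because x normalizes H and
    its square is in H. *)
Lemma gen_index2 H x : x \in 'N(H) -> x * x \in H ->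
  <<x |: H>> = H :|: x *: H.
Proof.
move=> Nx xxH; apply/eqP; rewrite eqEsubset; apply/andP; split; last first.
  rewrite subUset (subset_trans (subsetUr _ _) (subset_gen _)) /=.
  apply/subsetP=> _ /lcosetP[h Hh ->]; apply: groupM; apply: mem_gen.
    by rewrite setU11.
  by rewrite inE Hh orbT.
have gP : group_set (H :|: x *: H).
  apply/group_setP; split=> [|u v]; first by rewrite inE group1.
  have xE h : h \in H -> (h * x \in x *: H).
    by move=> Hh; rewrite -norm_rlcoset // mem_rcoset mulgK.
  rewrite !inE; case/orP=> [Hu|/lcosetP[h Hh ->]] /orP[Hv|/lcosetP[k Hk ->]].
  - by rewrite groupM.
  - rewrite mulgA; case/lcosetP: (xE _ Hu) => h Hh ->; apply/orP; right.
    by rewrite -mulgA mem_lcoset mulKg groupM.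
  - by apply/orP; right; rewrite -mulgA mem_lcoset mulKg groupM.
  rewrite -mulgA (mulgA h); case/lcosetP: (xE _ Hh) => h' Hh' ->.
  by apply/orP; left; rewrite mulgA mulgA -(mulgA _ h') groupM // groupM.
rewrite -(gen_set_id gP) genS // subUset sub1set subsetUl andbT.
by rewrite inE mem_lcoset mulVg group1 orbT.
Qed.

Lemma mem_cyclic_sub C H c : cyclic C -> H \subset C -> c \in C ->
  (c \in H) = (c ^+ #|H| == 1).
Proof.
move=> cycC sHC Cc; rewrite -cycle_subG -(cardSg_cyclic cycC) ?cycle_subG //.
by rewrite order_dvdn.
Qed.

Definition cycle_sub (a : gT) n : {group gT} := <[a ^+ (#[a] %/ n)]>%G.

Lemma cycle_subS a n : cycle_sub a n \subset <[a]>.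
Proof. exact: cycleX. Qed.

Lemma card_cycle_sub a n : n %| #[a] -> #|cycle_sub a n| = n.
Proof.
move=> dv; have : cycle_sub a n \in [set cycle_sub a n] by rewrite inE.
by rewrite -cycle_sub_group // inE => /andP[_ /eqP].
Qed.

(** The subgroup of order gcd(#|H|, #|K|) lies in both H and K, since in a
    cyclic group inclusion of subgroups is divisibility of orders. *)
Lemma card_cyclicI C H K : cyclic C -> H \subset C -> K \subset C ->
  #|H :&: K| = gcdn #|H| #|K|.
Proof.
move=> cycC sHC sKC; apply/eqP; rewrite eqn_dvd dvdn_gcd.
rewrite !cardSg ?subsetIl ?subsetIr //=.
have /cyclicP[a defC] := cycC.
have dvN : gcdn #|H| #|K| %| #[a].
  by rewrite (dvdn_trans (dvdn_gcdl _ _)) // orderE -defC cardSg.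
have sL : cycle_sub a (gcdn #|H| #|K|) \subset C by rewrite defC cycle_subS.
rewrite -{1}(card_cycle_sub dvN) cardSg // subsetI.
rewrite -[_ \subset H](cardSg_cyclic cycC) // -(cardSg_cyclic cycC sL) //.
by rewrite card_cycle_sub // dvdn_gcdl dvdn_gcdr.
Qed.

(** In an abelian group the relation x ^ y = x^-1 forces x ^+ 2 = 1, so both
    generators lie in the subgroup of order 2 of a cyclic group, which is too
    small. *)
Lemma dihedral_noncyclic G : is_dihedral G -> ~~ cyclic G.
Proof.
case/and3P=> G_gt3 evG isoG; apply/negP=> cycG.
have q_gt1 : (1 < #|G|./2)%N by rewrite -ltn_double even_halfK // ltnW.
have := Grp_dihedral q_gt1; rewrite even_halfK // => isoD.
have /existsP[[x y] /=] :
    G \homg Grp (x : y : x ^+ #|G|./2, y ^+ 2, x ^ y = x^-1).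
  by rewrite -isoD isog_hom.
rewrite !xpair_eqE /= => /and4P[/eqP defG _ /eqP y2 /eqP xy].
have abG := cyclic_abelian cycG.
have Gx : x \in G by rewrite -defG mem_gen // inE cycle_id.
have Gy : y \in G by rewrite -defG mem_gen // inE cycle_id orbT.
have x2 : x ^+ 2 = 1.
  rewrite expgS expg1 -{2}(invgK x) -xy.
  have -> : x ^ y = x by apply/conjg_fixP/commgP; apply: (centsP abG).
  by rewrite mulgV.
have /cyclicP[a defGa] := cycG.
have dv2 : 2 %| #[a] by rewrite orderE -defGa dvdn2.
have sL : cycle_sub a 2 \subset G by rewrite defGa cycle_subS.
have sGL : G \subset cycle_sub a 2.
  rewrite -{1}defG gen_subG subUset !cycle_subG !(mem_cyclic_sub cycG sL) //.
  by rewrite card_cycle_sub // x2 y2 eqxx.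
by move: (subset_leq_card sGL); rewrite card_cycle_sub // leqNgt ltnW.
Qed.

Lemma norm_unique_sub C H x : cyclic C -> H \subset C -> x \in 'N(C) ->
  x \in 'N(H).
Proof.
move=> cycC sHC; apply: (subsetP (char_norms _)).
by rewrite (sub_cyclic_char H cycC).
Qed.

(** If H is generated by h, the quotient is generated by the images of x and x
    * h, two distinct involutions. *)
Lemma dihedral_quotient Z H x : cyclic H -> H \subset 'N(Z) -> x \in 'N(Z) ->
  ~~ (H \subset Z) ->
  (forall h, h \in H -> x * h \notin Z /\ (x * h) * (x * h) \in Z) ->
  is_dihedral (<<x |: H>> / Z).
Proof.
move=> /cyclicP[h defH] nZH nZx nHZ xP.
have Hh : h \in H by rewrite defH cycle_id.
have nZh : h \in 'N(Z) := subsetP nZH _ Hh.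
have invol k : k \in H -> #[coset Z (x * k)] = 2.
  move=> Hk; have [xkZ xk2] := xP k Hk.
  have nxk : x * k \in 'N(Z) by rewrite groupM // (subsetP nZH).
  apply: nt_prime_order => //.
    by rewrite expgS expg1 -morphM //; apply: coset_id.
  by apply/negP=> /eqP/coset_idr-/(_ nxk); apply/negP.
have ox := invol 1 (group1 _); rewrite mulg1 in ox.
have oxh := invol h Hh.
have hZ : h \notin Z by rewrite defH cycle_subG in nHZ.
have neq : coset Z x != coset Z (x * h).
  apply/eqP; rewrite morphM //= -{1}[coset Z x]mulg1 => /mulgI/esym.
  by move/(coset_idr nZh); apply/negP.
have genE : <<x |: H>> / Z = <<[set coset Z x; coset Z (x * h)]>>.
  have -> : <<x |: H>> = <<[set x; x * h]>>.
    apply/eqP; rewrite eqEsubset !gen_subG !subUset !sub1set {1}defH cycle_subG.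
    have Kx : x \in <<[set x; x * h]>> by rewrite mem_gen ?set21.
    have Gx : x \in <<x |: H>> by rewrite mem_gen ?setU11.
    rewrite Kx Gx groupM ?andbT //=; last by rewrite mem_gen // inE Hh orbT.
    by rewrite -{1}(mulKg x h) groupM ?groupV // mem_gen ?set22.
  rewrite quotient_gen; last by rewrite subUset !sub1set nZx groupM.
  by rewrite /quotient morphimU !morphim_set1 // groupM.
have iso := involutions_gen_dihedral ox oxh neq; rewrite -genE in iso.
have ev : 2 %| #|<<x |: H>> / Z|.
  have : coset Z x \in <<x |: H>> / Z by rewrite genE mem_gen ?set21.
  by move/order_dvdG; rewrite ox.
rewrite /is_dihedral iso -dvdn2 ev !andbT.
suff : (2 < #|<<x |: H>> / Z|)%N by case: #|_| ev => [|[|[|[|]]]].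
have s1 : [set 1; coset Z x; coset Z (x * h)] \subset <<x |: H>> / Z.
  rewrite genE !subUset !sub1set group1 /=.
  by rewrite !mem_gen ?set21 ?set22.
apply: leq_trans (subset_leq_card s1); rewrite -setUA cardsU1 cards2 neq.
rewrite !inE negb_or ![1 == _]eq_sym -!order_eq1 ox oxh //.
Qed.

Lemma is_dihedralJ G x : is_dihedral (G :^ x) = is_dihedral G.
Proof.
rewrite /is_dihedral cardJg; congr [&& _, _ & _].
by rewrite (isog_transl _ (isog_symr (conj_isog G x))).
Qed.

End IndexTwo.

(** * A cyclic group with a Frobenius involution *)

Section TwistDef.
Local Open Scope group_scope.

(** The model is C = F_{q^2}^*, Z = F_q^*, and g the Frobenius automorphism of
    F_{q^2} over F_q, inside the semidirect product of C by g. *)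
Record frobenius_twist (gT : finGroupType) (C Z : {group gT}) (g : gT) (q : nat)
    : Prop := FrobeniusTwist {
  twist_odd : odd q;
  twist_gt1 : 1 < q;
  twist_cyclic : cyclic C;
  twist_card : #|C| = (q.-1 * q.+1)%N;
  twist_sub : Z \subset C;
  twist_cardZ : #|Z| = q.-1;
  twist_inv : g * g = 1;
  twist_notin : g \notin C;
  twist_conj : {in C, forall c, c ^ g = c ^+ q} }.

End TwistDef.

Section Twist.
Local Open Scope group_scope.
Variables (gT : finGroupType) (C Z : {group gT}) (g : gT) (q : nat).
Hypothesis T : frobenius_twist C Z g q.
Implicit Types (H G : {group gT}) (c d h x : gT).

Let q1_gt0 : 0 < q.-1. Proof. by case: q (twist_gt1 T) => [|[]]. Qed.
Let cycC := twist_cyclic T.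
Let abC : abelian C := cyclic_abelian cycC.
Let oC := twist_card T.
Let sZC := twist_sub T.
Let oZ := twist_cardZ T.

(** In the model c ^+ q.+1 is the norm of c from F_{q^2} to F_q. *)
Definition twist_norms (A : {set gT}) : {set gT} := [set h ^+ q.+1 | h in A].

(** Squares of elements of the coset g *: C are norms; this is what links
    extensions of H by such an element to the norms of H. *)
Lemma twist_sqr c : c \in C -> (g * c) * (g * c) = c ^+ q.+1.
Proof.
move=> Cc; have gV : g^-1 = g by rewrite -[LHS]mul1g -(twist_inv T) mulgK.
by rewrite expgSr -(twist_conj T Cc) conjgE gV !mulgA.
Qed.

Lemma twist_normC : g \in 'N(C).
Proof.
rewrite inE; apply/subsetP=> _ /imsetP[c Cc ->].
by rewrite (twist_conj T) // groupX.
Qed.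

Lemma twist_norm H c : H \subset C -> c \in C -> g * c \in 'N(H).
Proof.
move=> sHC Cc; apply: (norm_unique_sub cycC sHC).
by rewrite groupM ?twist_normC // (subsetP (normG C)).
Qed.

Lemma twist_coset_notin c : c \in C -> g * c \notin C.
Proof. by move=> Cc; rewrite groupMr // (twist_notin T). Qed.

Lemma pow_q1_in_Z c : c \in C -> c ^+ q.+1 \in Z.
Proof.
move=> Cc; rewrite (mem_cyclic_sub cycC) ?groupX // oZ -expgM mulnC -oC.
by rewrite expg_cardG.
Qed.

Lemma twist_norms_sub H : H \subset C -> twist_norms H \subset H :&: Z.
Proof.
move=> sHC; apply/subsetP=> _ /imsetP[h Hh ->].
by rewrite inE groupX // pow_q1_in_Z // (subsetP sHC).
Qed.

Lemma pow_q1_Z z : z \in Z -> z ^+ q.+1 = z ^+ 2.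
Proof.
move=> Zz; rewrite -[q.+1](subnK (_ : 2 <= q.+1)) ?ltnS ?(ltnW (twist_gt1 T)) //.
by rewrite expgD subSS subn1 -oZ expg_cardG // mul1g.
Qed.

(** Hilbert's theorem 90: elements of norm 1 are (q-1)-st powers, because C is
    cyclic of order (q - 1)(q + 1). *)
Lemma pow_q1_fibre c d : c \in C -> d \in C -> c ^+ q.+1 = d ^+ q.+1 ->
  exists2 j, j \in C & d = c * j ^+ q.-1.
Proof.
move=> Cc Cd eqcd; have /cyclicP[a defC] := cycC.
have: c^-1 * d \in C by rewrite groupM ?groupV.
rewrite {1}defC => /cycleP[k defk].
have : a ^+ (k * q.+1) = 1.
  rewrite expgM -defk expgMn; last by apply: (centsP abC); rewrite ?groupV.
  by rewrite expgVn eqcd mulVg.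
move/eqP; rewrite -order_dvdn orderE -defC oC dvdn_pmul2r // => /dvdnP[i ki].
exists (a ^+ i); first by rewrite defC mem_cycle.
by rewrite -expgM -ki -defk mulKVg.
Qed.

Section Extension.
Variables (H : {group gT}) (c : gT).
Hypotheses (sHC : H \subset C) (Cc : c \in C) (Hc : c ^+ q.+1 \in H).

Lemma twist_genE : <<g * c |: H>> = H :|: (g * c) *: H.
Proof. by rewrite gen_index2 ?twist_norm // twist_sqr. Qed.

Lemma twist_disjoint : [disjoint C & (g * c) *: H].
Proof.
rewrite disjoint_sym disjoints_subset; apply/subsetP=> _ /lcosetP[h Hh ->].
by rewrite inE (groupMr _ (subsetP sHC _ Hh)) twist_coset_notin.
Qed.

Lemma twist_genI : <<g * c |: H>> :&: C = H.
Proof.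
rewrite twist_genE setIUl (setIidPl sHC) setIC.
by rewrite (disjoint_setI0 twist_disjoint) setU0.
Qed.

Lemma twist_genD : <<g * c |: H>> :\: H = (g * c) *: H.
Proof.
rewrite twist_genE setDUl setDv set0U; apply/setDidPl.
by rewrite disjoint_sym; apply: disjointWl twist_disjoint; exact: sHC.
Qed.

Lemma card_twist_gen : #|<<g * c |: H>>| = (2 * #|H|)%N.
Proof.
rewrite twist_genE cardsU disjoint_setI0 ?cards0 ?subn0 ?card_lcoset //.
  by rewrite mul2n addnn.
by apply: disjointWl twist_disjoint; exact: sHC.
Qed.

Lemma twist_gen_sub : <<g * c |: H>> \subset C :|: g *: C.
Proof.
rewrite twist_genE setUSS // lcosetM; apply: mulgS.
by apply/subsetP=> _ /lcosetP[h Hh ->]; rewrite groupM // (subsetP sHC).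
Qed.

Lemma twist_gen_dihedral : ~~ (H \subset Z) -> is_dihedral (<<g * c |: H>> / Z).
Proof.
move=> nHZ; have nZC : C \subset 'N(Z) by rewrite (sub_abelian_norm abC).
apply: dihedral_quotient => //.
- exact: cyclicS cycC.
- exact: subset_trans nZC.
- exact: twist_norm.
move=> h Hh; have Cch : c * h \in C by rewrite groupM // (subsetP sHC).
rewrite -(mulgA g) twist_sqr // pow_q1_in_Z //; split=> //.
by apply: contra (twist_coset_notin Cch) => /(subsetP sZC).
Qed.

(** Conjugating g * c by j^-1 multiplies c by j ^+ q.-1, and elements with the
    same norm differ by such a factor. *)
Lemma twist_gen_conj d h : d \in C -> h \in H ->
  c ^+ q.+1 = (d * h) ^+ q.+1 ->
  exists j, <<g * c |: H>> :^ j = <<g * d |: H>>.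
Proof.
move=> Cd Hh /pow_q1_fibre[//||j Cj dh]; first by rewrite groupM // (subsetP sHC).
exists j^-1; rewrite -genJ conjUg conjg_set1.
have -> : (g * c) ^ j^-1 = g * d * h.
  rewrite -mulgA dh conjgE invgK mulgA.
  have -> : j * (g * c) = g * (j ^ g * c).
    by rewrite conjgE !mulgA mulgV mul1g.
  rewrite (twist_conj T) // -!mulgA; congr (_ * _).
  rewrite mulgA (centsP abC _ _ c) ?groupX // -mulgA; congr (_ * _).
  by rewrite -{1}(prednK (ltnW (twist_gt1 T))) expgSr mulgK.
have -> : H :^ j^-1 = H.
  apply: normP; rewrite groupV; apply: (subsetP _ j Cj).
  by rewrite (sub_abelian_norm abC).
apply/eqP; rewrite eqEsubset !gen_subG !subUset !sub1set.
rewrite !(subset_trans (subsetUr _ _) (subset_gen _)) !andbT.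
have Kx x : x \in <<x |: H>> by rewrite mem_gen ?setU11.
have Kh x : h \in <<x |: H>> by rewrite mem_gen // inE Hh orbT.
apply/andP; split; first exact: groupM (Kx _) (Kh _).
by rewrite -{1}(mulgK h (g * d)); exact: groupM (Kx _) (groupVr (Kh _)).
Qed.

End Extension.

(** If G were inside C its image would be cyclic, and if G :&: C were inside Z
    its image would have order at most 2. *)
Lemma twist_dihedral_gen (G : {group gT}) :
    G \subset C :|: g *: C -> is_dihedral (G / Z) ->
  ~~ (G :&: C \subset Z) /\
  exists c, [/\ c \in C, c ^+ q.+1 \in G :&: C
    & G = <<g * c |: G :&: C>> :> {set gT}].
Proof.
move=> sG dihG.
have nGC : ~~ (G \subset C).
  apply: contra (dihedral_noncyclic dihG) => sGC.
  by apply/quotient_cyclic/(cyclicS sGC).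
have [x Gx nCx] := subsetPn nGC.
have := subsetP sG _ Gx; rewrite inE (negPf nCx) /= => /lcosetP[c Cc defx].
have Hc : c ^+ q.+1 \in G :&: C.
  by rewrite inE (groupX _ Cc) andbT -twist_sqr // -defx groupM.
have defG : G = <<g * c |: G :&: C>> :> {set gT}.
  apply/eqP; rewrite -defx eqEsubset gen_subG subUset sub1set Gx subsetIl !andbT.
  apply/subsetP=> y Gy; have [Cy|nCy] := boolP (y \in C).
    by rewrite mem_gen // !inE Gy Cy orbT.
  have := subsetP sG _ Gy; rewrite inE (negPf nCy) /= => /lcosetP[d Cd defy].
  have -> : y = x * (c^-1 * d) by rewrite defx defy !mulgA mulgK.
  rewrite groupM ?mem_gen ?setU11 // !inE [c^-1 * d \in C]groupM ?groupV //.
  have -> : c^-1 * d = x^-1 * y by rewrite defx defy invMg -mulgA mulKg.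
  by rewrite groupM ?groupV ?orbT.
split; last by exists c.
apply/negP=> sHZ; case/and3P: dihG => + _ _; apply/negP; rewrite -leqNgt.
apply: leq_trans (_ : #|[set 1; coset Z x]| <= 3); last first.
  by rewrite cards2; case: (_ != _).
rewrite subset_leq_card // {1}defG twist_genE ?subsetIr //.
rewrite /quotient morphimU subUset; apply/andP; split.
  rewrite -/(_ / _); apply/subsetP=> _ /morphimP[y _ Hy ->].
  by rewrite /= (coset_id (subsetP sHZ _ Hy)) set21.
apply/subsetP=> _ /morphimP[z _ /lcosetP[y Hy ->{z}] ->] /=; rewrite -defx.
have Zy := subsetP sHZ _ Hy.
have nZx : x \in 'N(Z) by rewrite defx; apply: twist_norm.
by rewrite coset_morphM ?(subsetP (normG Z) _ Zy) // (coset_id Zy) mulg1 set22.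
Qed.

End Twist.

(** * Norms of a subgroup *)

Section Norms.
Local Open Scope group_scope.
Variables (gT : finGroupType) (C Z H : {group gT}) (g d : gT) (q : nat).
Hypothesis T : frobenius_twist C Z g q.
Hypotheses (defC : C = <[d]> :> {set gT}) (sHC : H \subset C).

Let ev1 : 2 %| q.-1.
Proof.
by have := twist_odd T; rewrite -{1}(prednK (ltnW (twist_gt1 T))) dvdn2.
Qed.
Let cycC := twist_cyclic T.
Let abC : abelian C := cyclic_abelian cycC.
Let oC := twist_card T.
Let sZC := twist_sub T.
Let oZ := twist_cardZ T.
Let e := #|Z : H :&: Z|.
Let a := (d ^+ e) ^+ q.+1.

Let Cd : d \in C. Proof. by rewrite defC cycle_id. Qed.
Let eA : (#|H :&: Z| * e)%N = q.-1.
Proof. by rewrite -oZ Lagrange // subsetIr. Qed.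
Let e_gt0 : 0 < e. Proof. exact: indexg_gt0. Qed.

Lemma cardHZ : #|H :&: Z| = gcdn #|H| q.-1.
Proof. by rewrite (card_cyclicI cycC) // oZ. Qed.

Lemma dvd2_HZ : (2 %| #|H :&: Z|) = (2 %| #|H|).
Proof. by rewrite cardHZ dvdn_gcd ev1 andbT. Qed.

(** Since d ^+ q.+1 generates Z, its power to the index of a subgroup of Z
    generates that subgroup. *)
Lemma cycle_HZ : H :&: Z = <[a]>.
Proof.
apply/eqP; rewrite (eq_subG_cyclic cycC) ?cycle_subG ?groupX //; last first.
  exact: subset_trans (subsetIl _ _) sHC.
rewrite -orderE /a -expgM orderXdiv orderE -defC oC -eA; last first.
  by rewrite -mulnA dvdn_mull.
by rewrite -mulnA mulnK // muln_gt0 e_gt0.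
Qed.

Lemma twist_normsM x y : x \in twist_norms q H -> y \in twist_norms q H ->
  x * y \in twist_norms q H.
Proof.
case/imsetP=> h Hh -> /imsetP[k Hk ->]; apply/imsetP; exists (h * k).
  exact: groupM.
by rewrite expgMn //; apply: (centsP abC); apply: (subsetP sHC).
Qed.

Lemma twist_normsV x : x \in twist_norms q H -> x^-1 \in twist_norms q H.
Proof.
case/imsetP=> h Hh ->; apply/imsetP; exists h^-1; first by rewrite groupV.
by rewrite expgVn.
Qed.

Let HZa i : a ^+ i \in H :&: Z. Proof. by rewrite cycle_HZ mem_cycle. Qed.

(** On Z the norm is squaring, so the even powers of a are norms of elements
    of H :&: Z. *)
Lemma expa_norms i : a ^+ i.*2 = (a ^+ i) ^+ q.+1.
Proof.
have /setIP[_ Za] := HZa i.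
by rewrite (pow_q1_Z T Za) -[RHS]expgM muln2.
Qed.

Lemma even_expa i : ~~ odd i -> a ^+ i \in twist_norms q H.
Proof.
move=> ev; apply/imsetP; exists (a ^+ i./2); last by rewrite -expa_norms even_halfK.
by have /setIP[] := HZa i./2.
Qed.

(** The norms of H lie between the squares of H :&: Z = <[a]> and <[a]>
    itself. If they miss some c ^+ q.+1 in <[a]>, then the squares have index
    2, every norm of H is a square, and c ^+ q.+1 is an odd power of a, that
    is the norm of d ^+ e times a square. *)
Lemma norm_index2 c :
    c \in C -> c ^+ q.+1 \in H -> c ^+ q.+1 \notin twist_norms q H ->
  [/\ 2 %| #|H|, twist_norms q H = twist_norms q (H :&: Z)
    & exists2 h, h \in H & c ^+ q.+1 = (d ^+ e * h) ^+ q.+1].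
Proof.
move=> Cc Hc nNc.
have HZc : c ^+ q.+1 \in H :&: Z by rewrite inE Hc (pow_q1_in_Z T).
have [k defk] : exists k, c ^+ q.+1 = a ^+ k.
  by move: HZc; rewrite cycle_HZ => /cycleP.
have odd_k : odd k by apply: contraR nNc; rewrite defk; apply: even_expa.
split.
- rewrite -dvd2_HZ dvdn2; apply: contra nNc => odd_A; rewrite defk.
  rewrite -[a ^+ k]mulg1 -(expg_cardG (HZa 1)) expg1 -expgD even_expa //.
  by rewrite oddD odd_k odd_A.
- apply/eqP; rewrite eqEsubset andbC imsetS ?subsetIl //=.
  apply/subsetP=> x Nx; have := subsetP (twist_norms_sub T sHC) _ Nx.
  rewrite cycle_HZ => /cycleP[i defx].
  have [odd_i|ev_i] := boolP (odd i).
    case/negP: nNc; rewrite defk -(mulgK (a ^+ i) (a ^+ k)) twist_normsM //.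
      by rewrite -expgD even_expa // oddD odd_k odd_i.
    by rewrite -defx twist_normsV.
  apply/imsetP; exists (a ^+ i./2); first exact: mem_cycle.
  by rewrite defx -expa_norms even_halfK.
exists (a ^+ k./2); first by have := HZa k./2; rewrite inE => /andP[].
rewrite defk -{1}(odd_double_half k) odd_k expgD expg1 expa_norms expgMn //.
by apply: (centsP abC); rewrite groupX // groupX // groupX.
Qed.

(** A generator of a cyclic group of even order is not a square. *)
Lemma twist_notin_norms : 2 %| #|H| -> twist_norms q H = twist_norms q (H :&: Z) ->
  a \notin twist_norms q H.
Proof.
rewrite -dvd2_HZ => evA ->; apply/imsetP=> -[z].
rewrite cycle_HZ => /cycleP[i ->]; rewrite -expa_norms => /eqP.
rewrite -{1}[a]expg1 eq_expg_mod_order orderE -cycle_HZ => /eqP eqi.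
have := congr1 (modn^~ 2) eqi; rewrite !modn_dvdm // !modn2 odd_double.
by [].
Qed.

Lemma card_norms : #|twist_norms q H| = (#|H| %/ gcdn #|H| q.+1)%N.
Proof.
have /cyclicP[h defH] := cyclicS sHC cycC.
have -> : twist_norms q H = <[h ^+ q.+1]>.
  apply/setP=> x; apply/imsetP/cycleP=> [[y]|[i ->]].
    by rewrite defH => /cycleP[i ->] ->; exists i; rewrite -!expgM mulnC.
  by exists (h ^+ i); rewrite ?defH ?mem_cycle // -!expgM mulnC.
by rewrite -orderE orderXgcd orderE -defH.
Qed.

(** Compare the orders of the norms of H and of H :&: Z: these are n / gcd(n,
    q + 1) and gcd(n, q - 1) with n = #|H|, and for n even the product of the
    two gcds is gcd(2n, q^2 - 1). *)
Lemma mem_norms_card : 2 %| #|H| -> (a \in twist_norms q H) = ~~ (2 * #|H| %| #|C|).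
Proof.
move=> evH; set n := #|H|.
have n_gt0 : 0 < n := cardG_gt0 H.
have n_dvd : n %| #|C| by rewrite cardSg.
have g2 : gcdn (gcdn n q.+1) q.-1 = 2.
  have q3 : q.+1 = (2 + q.-1)%N by rewrite add2n (prednK (ltnW (twist_gt1 T))).
  apply/eqP; rewrite eqn_dvd !dvdn_gcd evH ev1 q3 dvdn_addr // ev1 !andbT.
  by rewrite -gcdnA (dvdn_trans (dvdn_gcdr _ _)) // gcdnC gcdnDr dvdn_gcdr.
have gg : (gcdn n q.-1 * gcdn n q.+1 = gcdn (n * 2) #|C|)%N.
  by rewrite oC muln_gcdl (muln_gcdr q.-1) gcdnA (mulnC q.-1 n) -muln_gcdr g2.
have -> : (a \in twist_norms q H) = (#|H :&: Z| <= #|twist_norms q H|).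
  apply/idP/idP=> [Na|leAN].
    apply: subset_leq_card; rewrite cycle_HZ; apply/subsetP=> _ /cycleP[i ->].
    elim: i => [|i IHi]; first exact: even_expa.
    by rewrite expgS twist_normsM.
  have /eqP -> : twist_norms q H == H :&: Z by rewrite eqEcard (twist_norms_sub T).
  by rewrite cycle_HZ cycle_id.
rewrite cardHZ card_norms leq_divRL ?gcdn_gt0 ?n_gt0 // gg.
case/dvdnP: n_dvd => k ->; rewrite dvdn_pmul2r // (mulnC k) -muln_gcdr.
rewrite -/n -{2}[n]muln1 leq_pmul2l //.
have [dv2|ndv] := boolP (2 %| k); first by rewrite (gcdn_idPl dv2).
by rewrite (eqnP (_ : coprime 2 k)) // prime_coprime.
Qed.
End Norms.

(** * Counting divisors *)

(** The divisors of a that divide b are all the divisors of b. *)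
Lemma size_nondivisors a b : 0 < a -> b %| a ->
  size [seq n <- divisors a | ~~ (n %| b)] + tau b = tau a.
Proof.
move=> a_gt0 b_dv; have b_gt0 := dvdn_gt0 a_gt0 b_dv.
rewrite size_filter /tau -(count_predC (dvdn^~ b) (divisors a)) addnC.
congr addn; rewrite -size_filter; apply/perm_size/uniq_perm.
- exact: divisors_uniq.
- by rewrite filter_uniq ?divisors_uniq.
move=> n; rewrite mem_filter -!dvdn_divisors //; case dv: (n %| b) => //=.
by rewrite (dvdn_trans dv b_dv).
Qed.

(** Halving the entries reduces this to the previous count. *)
Lemma size_even_nondivisors a b : 0 < a -> b %| a ->
  size [seq n <- divisors (4 * a) | ~~ (n %| 2 * b) & (2 %| n) && (2 * n %| 4 * a)]
    + tau b = tau a.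
Proof.
move=> a_gt0 b_dv; rewrite -(size_nondivisors a_gt0 b_dv); congr addn.
rewrite -[RHS](size_map (muln 2)); apply/perm_size/uniq_perm.
- by rewrite filter_uniq ?divisors_uniq.
- rewrite map_inj_uniq ?filter_uniq ?divisors_uniq // => x y /eqP.
  by rewrite eqn_pmul2l // => /eqP.
have a4_gt0 : 0 < 4 * a by rewrite muln_gt0.
move=> n; rewrite mem_filter -dvdn_divisors //; apply/idP/mapP.
  case/andP=> /and3P[n_b /dvdnP[m defn] n_a] _; exists m; last by rewrite defn mulnC.
  rewrite mem_filter -dvdn_divisors //; move: n_b n_a.
  by rewrite defn mulnC mulnA dvdn_pmul2l // dvdn_pmul2l // => -> ->.
case=> m; rewrite mem_filter -dvdn_divisors // => /andP[m_b m_a] ->.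
rewrite dvdn_pmul2l // m_b dvdn_mulr // mulnA dvdn_pmul2l // m_a /=.
by rewrite (dvdn_trans (dvdn_mull 2 (dvdnn _))) // mulnA dvdn_pmul2l.
Qed.

(** * The classification of the dihedral groups *)

Import GRing.Theory.

Section Classification.
Local Open Scope group_scope.
Variables (gT : finGroupType) (C Z : {group gT}) (g d m1 : gT) (q : nat).
Variables (R : finComNzRingType) (det : gT -> R).
Hypothesis T : frobenius_twist C Z g q.
Hypothesis defC : C = <[d]> :> {set gT}.
Hypothesis centZ : forall z x : gT, z \in Z -> commute z x.
Hypothesis sNC : 'N(C) \subset C :|: g *: C.
Hypothesis det1 : det 1 = 1%R.
Hypothesis detM : {morph det : x y / x * y >-> (x * y)%R}.
Hypothesis detg : det g = (-1)%R.
Hypothesis det_norm :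
  {in C &, forall c c', det c = det c' <-> c ^+ q.+1 = c' ^+ q.+1}.
Hypotheses (Zm1 : m1 \in Z) (m1_sqr : m1 * m1 = 1) (m1_neq1 : m1 != 1).
Implicit Types (H K G : {group gT}) (c h x : gT).

Let q_gt0 : 0 < q := ltnW (twist_gt1 T).
Let q1_gt0 : 0 < q.-1. Proof. by case: q (twist_gt1 T) => [|[]]. Qed.
Let cycC := twist_cyclic T.
Let abC : abelian C := cyclic_abelian cycC.
Let oC := twist_card T.
Let sZC := twist_sub T.
Let oZ := twist_cardZ T.
Let Cd : d \in C. Proof. by rewrite defC cycle_id. Qed.
Let od : #[d] = #|C|. Proof. by rewrite defC. Qed.
Let nZ x : x \in 'N(Z).
Proof.
rewrite inE; apply/subsetP=> _ /imsetP[z Zz ->].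
by rewrite conjgE (centZ x Zz) mulKg.
Qed.

Definition dets (A : {set gT}) : {set R} := [set det x | x in A].
Definition opp_dets (A : {set gT}) : {set R} := [set (- det x)%R | x in A].
Definition ext1 (A : {set gT}) : {set gT} := <<g |: A>>.
(** The exponent is chosen so that the norm of the power of d generates A :&:
    Z. *)
Definition ext2 (A : {set gT}) : {set gT} := <<g * d ^+ #|Z : A :&: Z| |: A>>.
Definition dihedrals : {set {group gT}} :=
  [set G : {group gT} |
     [exists K : {set gT}, [exists x, K == C :^ x] && (G \subset 'N(K))]
     && is_dihedral (G / Z)].

Lemma ext1E (A : {set gT}) : ext1 A = <<g * 1 |: A>>.
Proof. by rewrite mulg1. Qed.

Lemma dets_norms H K : H \subset C -> K \subset C ->
  dets H = dets K <-> twist_norms q H = twist_norms q K.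
Proof.
move=> sHC sKC; split=> eqHK; apply/setP=> x.
  apply/imsetP/imsetP=> -[h Ah ->].
    have : det h \in dets K by rewrite -eqHK imset_f.
    case/imsetP=> k Kk /(det_norm (subsetP sHC _ Ah) (subsetP sKC _ Kk)).
    by exists k.
  have : det h \in dets H by rewrite eqHK imset_f.
  case/imsetP=> k Kk /(det_norm (subsetP sKC _ Ah) (subsetP sHC _ Kk)).
  by exists k.
apply/imsetP/imsetP=> -[h Ah ->].
  have : h ^+ q.+1 \in twist_norms q K by rewrite -eqHK; apply: imset_f.
  case/imsetP=> k Kk /(det_norm (subsetP sHC _ Ah) (subsetP sKC _ Kk)).
  by exists k.
have : h ^+ q.+1 \in twist_norms q H by rewrite eqHK; apply: imset_f.
case/imsetP=> k Kk /(det_norm (subsetP sKC _ Ah) (subsetP sHC _ Kk)).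
by exists k.
Qed.

(** A cyclic group has at most one element of order 2, and m1 is the one in C. *)
Lemma m1_even H : H \subset C -> (m1 \in H) = (2 %| #|H|).
Proof.
move=> sHC; have m1_2 : m1 ^+ 2 = 1 by rewrite expgS expg1.
have o2 : #[m1] = 2 by apply: nt_prime_order => //; apply/eqP.
by rewrite (mem_cyclic_sub cycC sHC) ?(subsetP sZC) // -order_dvdn o2.
Qed.

Lemma det_conj x y : det (x ^ y) = det x.
Proof. by rewrite conjgE detM mulrC -detM mulgK. Qed.

Lemma opp_dets_coset c H : opp_dets ((g * c) *: H) = dets (c *: H).
Proof.
apply/setP=> x; apply/imsetP/imsetP=> [] [_ /lcosetP[h Hh ->] ->].
  exists (c * h); first by rewrite mem_lcoset mulKg.
  by rewrite -mulgA (detM g) detg mulN1r opprK.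
exists (g * c * h); first by rewrite mem_lcoset mulKg.
by rewrite -mulgA (detM g) detg mulN1r opprK.
Qed.

Lemma ext1_props H : H \subset C -> ~~ (H \subset Z) ->
  [/\ ext1 H \subset C :|: g *: C, is_dihedral (ext1 H / Z),
      H = ext1 H :&: C :> {set gT} & dets H = opp_dets (ext1 H :\: H)].
Proof.
move=> sHC nHZ; have C1 : 1 \in C by [].
have H1 : 1 ^+ q.+1 \in H by rewrite expg1n.
rewrite ext1E; split.
- exact: (twist_gen_sub T).
- exact: (twist_gen_dihedral T).
- by rewrite (twist_genI T).
- by rewrite (twist_genD T) // opp_dets_coset mul1g.
Qed.

Lemma norm_dexp_in H : H \subset C ->
  (d ^+ #|Z : H :&: Z|) ^+ q.+1 \in H.
Proof.
move=> sHC; have := cycle_id ((d ^+ #|Z : H :&: Z|) ^+ q.+1).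
by rewrite -(cycle_HZ T defC sHC) inE => /andP[].
Qed.

(** Since -det (g * d ^+ e * k) = det (d ^+ e * k), a common element of the
    two sets would make the norm of d ^+ e a norm of H. *)
Lemma ext2_props H : H \subset C -> ~~ (H \subset Z) ->
    dets H = dets (H :&: Z) -> m1 \in H ->
  [/\ ext2 H \subset C :|: g *: C, is_dihedral (ext2 H / Z),
      H = ext2 H :&: C :> {set gT} & [disjoint dets H & opp_dets (ext2 H :\: H)]].
Proof.
move=> sHC nHZ detH Hm1; have Ce : d ^+ #|Z : H :&: Z| \in C by rewrite groupX.
have He := norm_dexp_in sHC.
have sHZC : H :&: Z \subset C := subset_trans (subsetIl _ _) sHC.
have notN : (d ^+ #|Z : H :&: Z|) ^+ q.+1 \notin twist_norms q H.
  apply: (twist_notin_norms T defC sHC); first by rewrite -m1_even.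
  exact/(dets_norms sHC sHZC).
split.
- exact: (twist_gen_sub T).
- exact: (twist_gen_dihedral T).
- by rewrite (twist_genI T).
rewrite (twist_genD T) // opp_dets_coset disjoints_subset.
apply/subsetP=> _ /imsetP[h Hh ->]; rewrite inE.
apply/imsetP=> -[_ /lcosetP[k Hk ->]].
have Ch := subsetP sHC _ Hh; have Ck := subsetP sHC _ Hk.
move/(det_norm Ch (groupM Ce Ck)).
rewrite expgMn; last by apply: (centsP abC).
move=> eqh; case/negP: notN.
have -> : (d ^+ #|Z : H :&: Z|) ^+ q.+1 = h ^+ q.+1 * (k ^+ q.+1)^-1.
  by rewrite eqh mulgK.
have Nh : h ^+ q.+1 \in twist_norms q H by apply: imset_f.
have Nk : (k ^+ q.+1)^-1 \in twist_norms q H by apply/twist_normsV/imset_f.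
exact: twist_normsM T sHC _ _ Nh Nk.
Qed.

(** After conjugation G is generated by some g * c and H = G :&: C; the two
    cases are whether or not the norm of c is a norm of H. *)
Lemma dihedrals_classify G : G \in dihedrals ->
  exists (x : gT) (H : {group gT}), [/\ H \subset C, ~~ (H \subset Z)
    & G :^ x = ext1 H \/
      [/\ dets H = dets (H :&: Z), m1 \in H & G :^ x = ext2 H]].
Proof.
rewrite inE => /andP[/existsP[K /andP[/existsP[x /eqP ->]]]].
rewrite normJ -sub_conjgV => sGN dihG.
have sG : (G :^ x^-1)%G \subset C :|: g *: C := subset_trans sGN sNC.
have dihGx : is_dihedral ((G :^ x^-1)%G / Z).
  by rewrite /= quotientJ // is_dihedralJ.
have := twist_dihedral_gen T sG dihGx.
pose H := ((G :^ x^-1)%G :&: C)%G; rewrite -[_ :&: C]/(gval H).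
case=> nHZ [c [Cc Hc /= defG]].
have sHC : H \subset C := subsetIr _ _.
have [/imsetP[h Hh eqch]|notN] := boolP (c ^+ q.+1 \in twist_norms q H).
  have [j defj] : exists j, <<g * c |: H>> :^ j = <<g * 1 |: H>>.
    by apply: (twist_gen_conj T sHC Cc _ Hh); rewrite ?mul1g.
  exists (x^-1 * j), H; split=> //; left.
  by rewrite conjsgM ext1E -defj -defG.
have [evH normH [h Hh eqch]] := norm_index2 T defC sHC Cc Hc notN.
have [j defj] : exists j, <<g * c |: H>> :^ j = ext2 H.
  by apply: (twist_gen_conj T sHC Cc _ Hh); rewrite ?groupX.
exists (x^-1 * j), H; split=> //; right; split.
- by apply/dets_norms => //; apply: subset_trans sHC; apply: subsetIl.
- by rewrite m1_even.
- by rewrite conjsgM -defj -defG.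
Qed.

(** This turns the two conditions of the second family into a condition on the
    order of H alone, which is what is counted. *)
Lemma type2_card H : H \subset C ->
  (dets H = dets (H :&: Z) /\ m1 \in H) <-> (2 %| #|H|) && (2 * #|H| %| #|C|).
Proof.
move=> sHC; rewrite m1_even //.
have sHZC : H :&: Z \subset C := subset_trans (subsetIl _ _) sHC.
split=> [[/(dets_norms sHC sHZC) normH evH]|/andP[evH dvH]].
  rewrite evH; have := twist_notin_norms T defC sHC evH normH.
  by rewrite (mem_norms_card T defC sHC evH) negbK.
split=> //; apply/(dets_norms sHC sHZC).
have [] // := norm_index2 T defC sHC (groupX #|Z : H :&: Z| Cd) (norm_dexp_in sHC).
by rewrite (mem_norms_card T defC sHC evH) negbK.
Qed.

Lemma ext_dihedrals (G : {group gT}) :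
  G \subset C :|: g *: C -> is_dihedral (G / Z) -> G \in dihedrals.
Proof.
move=> sG dihG; rewrite inE dihG andbT; apply/existsP; exists (gval C).
apply/andP; split; first by apply/existsP; exists 1; rewrite conjsg1.
apply: subset_trans sG _; rewrite subUset normG /=.
apply/subsetP=> _ /lcosetP[c Cc ->].
exact: (twist_norm T (subxx C)).
Qed.

Lemma card_ext1 H : H \subset C -> #|ext1 H| = (2 * #|H|)%N.
Proof. by move=> sHC; rewrite ext1E (card_twist_gen T) // expg1n. Qed.

Lemma card_ext2 H : H \subset C -> #|ext2 H| = (2 * #|H|)%N.
Proof.
by move=> sHC; rewrite (card_twist_gen T sHC (groupX _ Cd)) // norm_dexp_in.
Qed.

Lemma detsJ (A : {set gT}) x : dets (A :^ x) = dets A.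
Proof.
apply/setP=> y; apply/imsetP/imsetP=> [[_ /imsetP[a Aa ->] ->]|[a Aa ->]].
  by exists a; rewrite ?det_conj.
by exists (a ^ x); rewrite ?memJ_conjg ?det_conj.
Qed.

(** The subgroup H need not be recoverable from the group it generates (the
    image may be a Klein group), but the set of determinants, invariant under
    conjugation, differs between the two groups. *)
Lemma ext1_ext2_not_conj H x : H \subset C -> ~~ (H \subset Z) ->
  dets H = dets (H :&: Z) -> m1 \in H -> ext1 H :^ x <> ext2 H.
Proof.
move=> sHC nHZ detH Hm1 conj12.
have [_ _ HE disj] := ext2_props sHC nHZ detH Hm1.
have eqdet : dets (ext1 H) = dets (ext2 H) by rewrite -conj12 detsJ.
have in_disj h y : h \in H -> y \in ext2 H -> y \notin H -> det h <> (- det y)%R.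
  move=> Hh Gy nHy eqhy.
  move: disj; rewrite disjoints_subset => /subsetP/(_ (det h)).
  rewrite imset_f // inE => /(_ isT)/negP; apply; rewrite eqhy.
  by apply/imsetP; exists y; rewrite // inE nHy.
(* As det g = -1 lies in the common set of determinants, disjointness puts
   -1 in det H. *)
have : det g \in dets (ext2 H).
  by rewrite -eqdet; apply: imset_f; rewrite mem_gen ?setU11.
case/imsetP=> y Gy; rewrite detg => dety.
have Hy : y \in H.
  apply/negPn/negP=> nHy; case: (in_disj 1 y) => //.
  by rewrite -dety opprK.
(* Now det H = - det H, so the determinant of the second generator would lie
   in both of the disjoint sets. *)
set z := g * d ^+ #|Z : H :&: Z|.
have Gz : z \in ext2 H by rewrite mem_gen ?setU11.
have nHz : z \notin H.
  have nCz : z \notin C by apply/(twist_coset_notin T)/groupX.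
  by apply: contra nCz => /(subsetP sHC).
have : det z \in dets (ext1 H) by rewrite eqdet imset_f.
case/imsetP=> v; rewrite ext1E (twist_genE T) // ?expg1n // mulg1.
case/setUP=> [Hv|/lcosetP[h Hh ->]].
  move=> detz; case: (in_disj (y * v) z) => //; first exact: groupM.
  by rewrite detM -dety mulN1r detz.
by rewrite detM detg mulN1r => detz; case: (in_disj h z) => //; rewrite detz opprK.
Qed.

Definition conj_class (G : {set gT}) : {set {set gT}} := G :^: [set: gT].

Lemma conj_classP (A B : {set gT}) :
  reflect (exists x, B = A :^ x) (conj_class A == conj_class B).
Proof.
apply: (iffP eqP) => [eqAB | [x ->]].
  have : B \in conj_class A.
    by rewrite eqAB; apply/imsetP; exists 1; rewrite ?inE // conjsg1.
  by case/imsetP=> x _ ->; exists x.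
apply/setP=> D; apply/imsetP/imsetP=> [[y _ ->]|[y _ ->]].
  by exists (x^-1 * y); rewrite ?inE // -conjsgM mulKVg.
by exists (x * y); rewrite ?inE // conjsgM.
Qed.

Let N := #|C|.
Let ns1 := [seq n <- divisors N | ~~ (n %| q.-1)].
Let ns2 := [seq n <- divisors N | ~~ (n %| q.-1) & (2 %| n) && (2 * n %| N)].
Let sub n := cycle_sub d n.
Let N_gt0 : 0 < N. Proof. exact: cardG_gt0. Qed.

Let ns1P n : n \in ns1 ->
  [/\ sub n \subset C, #|sub n| = n & ~~ (sub n \subset Z)].
Proof.
rewrite mem_filter -dvdn_divisors // => /andP[n_q n_N].
have on : #|sub n| = n by rewrite card_cycle_sub // od.
have sC : sub n \subset C by rewrite defC cycle_subS.
by split=> //; rewrite -(cardSg_cyclic cycC) // on oZ.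
Qed.

Let ns2_sub n : n \in ns2 -> n \in ns1.
Proof. by rewrite !mem_filter => /andP[/andP[-> _] ->]. Qed.

Let ns2P n : n \in ns2 -> dets (sub n) = dets (sub n :&: Z) /\ m1 \in sub n.
Proof.
move=> n2; have [sC on _] := ns1P (ns2_sub n2).
by apply/(type2_card sC); rewrite on; move: n2; rewrite mem_filter => /andP[/andP[]].
Qed.

Let subE H : H \subset C -> H = sub #|H| :> {set gT}.
Proof.
move=> sHC; apply/eqP; rewrite (eq_subG_cyclic cycC) ?card_cycle_sub //.
  by rewrite od cardSg.
by rewrite defC cycle_subS.
Qed.

Let classes := [seq conj_class (ext1 (sub n)) | n <- ns1]
  ++ [seq conj_class (ext2 (sub n)) | n <- ns2].

Lemma classes_uniq : uniq classes.
Proof.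
rewrite cat_uniq; apply/and3P; split.
- rewrite map_inj_in_uniq ?filter_uniq ?divisors_uniq // => m n m1' n1.
  move/eqP/conj_classP=> [x eqmn].
  have [sm om _] := ns1P m1'; have [sn on _] := ns1P n1.
  have := congr1 (fun A : {set gT} => #|A|) eqmn.
  rewrite cardJg !card_ext1 // om on => /eqP; rewrite eqn_pmul2l // => /eqP //.
- apply/hasPn=> _ /mapP[n n2 ->]; apply/negP=> /mapP[m m1' /esym/eqP].
  case/conj_classP=> x eqmn.
  have [sm om _] := ns1P m1'; have [sn on nZn] := ns1P (ns2_sub n2).
  have := congr1 (fun A : {set gT} => #|A|) eqmn.
  rewrite cardJg card_ext1 // card_ext2 // om on => /eqP.
  rewrite eqn_pmul2l // => /eqP eqm.
  have [detn m1n] := ns2P n2.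
  by case: (@ext1_ext2_not_conj (sub n) x sn nZn detn m1n); rewrite eqmn eqm.
rewrite map_inj_in_uniq ?filter_uniq ?divisors_uniq // => m n m2 n2.
move/eqP/conj_classP=> [x eqmn].
have [sm om _] := ns1P (ns2_sub m2); have [sn on _] := ns1P (ns2_sub n2).
have := congr1 (fun A : {set gT} => #|A|) eqmn.
by rewrite cardJg !card_ext2 // om on => /eqP; rewrite eqn_pmul2l // => /eqP.
Qed.

Lemma classes_mem : [set conj_class G | G : {group gT} in dihedrals] =i classes.
Proof.
move=> D; rewrite mem_cat; apply/imsetP/orP=> [[G dG ->]|].
  have [x [H [sHC nHZ GE]]] := dihedrals_classify dG.
  have oH : #|H| \in ns1.
    rewrite mem_filter -dvdn_divisors // cardSg // andbT.
    by rewrite -oZ (cardSg_cyclic cycC).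
  case: GE => [GE|[detH Hm1 GE]].
    left; apply/mapP; exists #|H| => //; apply/eqP/conj_classP; exists x.
    by rewrite -subE // GE.
  right; apply/mapP; exists #|H|.
    have := (type2_card sHC).1 (conj detH Hm1).
    by move: oH; rewrite !mem_filter => /andP[-> ->] ->.
  apply/eqP/conj_classP; exists x.
  by rewrite -subE // GE.
case=> /mapP[n nn ->].
  have [sn on nZn] := ns1P nn; have [sE dihE _ _] := ext1_props sn nZn.
  by exists <<g |: sub n>>%G => //; apply: ext_dihedrals.
have [sn on nZn] := ns1P (ns2_sub nn); have [detn m1n] := ns2P nn.
have [sE dihE _ _] := ext2_props sn nZn detn m1n.
by exists <<(g * d ^+ #|Z : sub n :&: Z|)%g |: sub n>>%G => //; apply: ext_dihedrals.
Qed.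

(** With q - 1 = 2k, the two lists of orders are counted by the divisors of
    q^2 - 1 = 4k(k + 1) not dividing 2k, and by those of k(k + 1) not dividing
    k. *)
Lemma card_classes :
  (#|[set conj_class G | G : {group gT} in dihedrals]|%:Z
     = (tau (q ^ 2 - 1))%:Z - (tau (q - 1))%:Z
       + (tau ((q ^ 2 - 1) %/ 4))%:Z - (tau ((q - 1) %/ 2))%:Z)%R.
Proof.
rewrite (eq_card classes_mem) (card_uniqP classes_uniq) size_cat !size_map.
have qN : (q ^ 2 - 1 = N)%N.
  rewrite /N oC -{1}(prednK q_gt0) -[1%N in LHS](exp1n 2).
  by rewrite subn_sqr subn1 addn1 prednK.
have [k q1E] : exists k, q.-1 = (2 * k)%N.
  exists q.-1./2; rewrite mul2n even_halfK //.
  by have := twist_odd T; rewrite -{1}(prednK q_gt0).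
have NE : N = (4 * (k * k.+1))%N.
  rewrite /N oC -{2}(prednK q_gt0) q1E -[4]/(2 * 2)%N -!mulnA; congr muln.
  by rewrite mulnCA; congr muln; rewrite mulnS mul2n.
have k_gt0 : 0 < k by move: q1_gt0; rewrite q1E muln_gt0.
have e1 : size ns1 + tau q.-1 = tau N.
  by apply: size_nondivisors => //; rewrite /N oC dvdn_mulr.
have e2 : size ns2 + tau k = tau (k * k.+1).
  rewrite /ns2 NE q1E; apply: size_even_nondivisors; last exact: dvdn_mulr.
  by rewrite muln_gt0 k_gt0.
rewrite qN subn1 {2}NE q1E !mulKn // -q1E -e1 -e2 !PoszD.
by rewrite addrK addrA addrK.
Qed.

End Classification.

(** * Two by two matrices *)

Local Open Scope ring_scope.

Section Mx22.
Variable R : comNzRingType.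
Implicit Types a b c d : R.

Lemma mx22_eqP a b c d a' b' c' d' :
  (mx22 a b c d = mx22 a' b' c' d') <-> [/\ a = a', b = b', c = c' & d = d'].
Proof.
split=> [/matrixP E|[-> -> -> ->] //].
have := (E 0 0, E 0 1, E 1 0, E 1 1).
by rewrite !mxE /= => -[[[]]].
Qed.

Lemma mx22_eta (M : 'M[R]_2) : M = mx22 (M 0 0) (M 0 1) (M 1 0) (M 1 1).
Proof.
apply/matrixP=> i j; rewrite !mxE.
case: i => [[|[|//]] p]; case: j => [[|[|//]] p'] /=; congr (M _ _); exact: val_inj.
Qed.

Lemma mul_mx22 a b c d a' b' c' d' :
  mx22 a b c d *m mx22 a' b' c' d' =
  mx22 (a * a' + b * c') (a * b' + b * d') (c * a' + d * c') (c * b' + d * d').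
Proof.
rewrite [LHS]mx22_eta; apply/mx22_eqP; split;
by rewrite !mxE !big_ord_recl big_ord0 addr0 !mxE.
Qed.

Lemma det_mx22 a b c d : \det (mx22 a b c d) = a * d - b * c.
Proof.
rewrite (expand_det_row _ 0) !big_ord_recl big_ord0 addr0 /cofactor !det_mx11.
by rewrite !mxE /= /bump /= expr0 expr1 mul1r mulN1r mulrN.
Qed.

Lemma scalar_mx22 a : a%:M = mx22 a 0 0 a.
Proof. by rewrite [LHS]mx22_eta; apply/mx22_eqP; split; rewrite !mxE. Qed.
End Mx22.

(** * The non-split Cartan group *)

Section Cartan.
Variables (ell : nat) (eps : 'F_ell).
Local Notation F := 'F_ell.
Local Notation GL := {'GL_2[F]}.
Local Notation E x y := (mx22 x (eps * y) y x : 'M[F]_2).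
Implicit Types (g h c n : GL) (x y : F).

Lemma GL_inj g h : GLval g = GLval h -> g = h.
Proof. exact: val_inj. Qed.

Lemma GL_exists (M : 'M[F]_2) : \det M != 0 -> exists g : GL, GLval g = M.
Proof.
move=> dM; have uM : M \is a GRing.unit.
  by rewrite -[_ \is a _]/(M \in unitmx) unitmxE unitfE.
by exists (FinRing.unit _ uM).
Qed.

Lemma GL_X g k : GLval (g ^+ k)%g = GLval g ^+ k.
Proof. exact: FinRing.val_unitX. Qed.

Lemma gammaE : GLval (gammaGL ell) = mx22 1 0 0 (-1). Proof. by []. Qed.

Lemma gamma2 : (gammaGL ell * gammaGL ell = 1)%g.
Proof.
apply: GL_inj; rewrite GL_MxE gammaE mul_mx22 -[RHS]/(1%:M) scalar_mx22.
by apply/mx22_eqP; split; ring.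
Qed.

Lemma gammaV : ((gammaGL ell)^-1 = gammaGL ell)%g.
Proof. by rewrite -[LHS]mul1g -gamma2 mulgK. Qed.

Lemma mul_E x y x' y' :
  E x y *m E x' y' = E (x * x' + eps * (y * y')) (x * y' + y * x').
Proof. by rewrite mul_mx22; apply/mx22_eqP; split; ring. Qed.

Lemma det_E x y : \det (E x y) = x ^+ 2 - eps * y ^+ 2.
Proof. by rewrite det_mx22; ring. Qed.

Lemma E_inj x y x' y' : E x y = E x' y' -> x = x' /\ y = y'.
Proof. by case/mx22_eqP. Qed.

Hypotheses (ell_prime : prime ell) (ell_odd : odd ell).
Hypotheses (eps_unit : eps \is a GRing.unit).
Hypothesis eps_nonsquare : ~ exists a : F, eps = a ^+ 2.

(** The norm form x^2 - eps y^2 is anisotropic as eps is not a square. *)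
Lemma det_E_neq0 x y : (x, y) != (0, 0) -> \det (E x y) != 0.
Proof.
apply: contraNneq => /eqP; rewrite det_E subr_eq0 => /eqP xy.
have [y0|ny] := eqVneq y 0.
  by move/eqP: xy; rewrite y0 expr0n mulr0 expf_eq0 /= => /eqP ->.
case: eps_nonsquare; exists (x / y).
by rewrite expr_div_n xy mulfK // expf_neq0.
Qed.

Lemma CnsP g : reflect (exists x y, GLval g = E x y) (g \in Cns eps).
Proof.
rewrite inE; apply: (iffP existsP) => [[x] | [x [y gE]]].
  by case/existsP=> y /andP[_ /eqP gE]; exists x, y.
exists x; apply/existsP; exists y; rewrite -gE eqxx andbT.
apply/eqP=> -[x0 y0]; have := GL_det g; rewrite gE det_E x0 y0.
by rewrite !expr0n mulr0 subr0 eqxx.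
Qed.

Lemma Cns_exists x y : (x, y) != (0, 0) ->
  exists2 g : GL, g \in Cns eps & GLval g = E x y.
Proof.
by case/det_E_neq0/GL_exists => g gE; exists g => //; apply/CnsP; exists x, y.
Qed.

(** The first column identifies C with the nonzero vectors of F^2. *)
Lemma card_Cns : #|Cns eps| = (ell.-1 * ell.+1)%N.
Proof.
pose f g := (GLval g 0 0, GLval g 1 0) : F * F.
have f_inj : {in Cns eps &, injective f}.
  move=> g h /CnsP[x [y gE]] /CnsP[x' [y' hE]]; rewrite /f gE hE.
  rewrite !mxE /= => -[xx yy].
  by apply: GL_inj; rewrite gE hE xx yy.
rewrite -(card_in_imset f_inj).
have -> : f @: Cns eps = [set~ (0, 0)].
  apply/setP=> -[x y]; rewrite !inE; apply/imsetP/idP=> [[g]|/Cns_exists[g Cg gE]].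
    case/CnsP=> x' [y' gE]; rewrite /f gE !mxE /= => -[-> ->] {x y}.
    apply/eqP=> -[x0 y0]; have := GL_det g.
    by rewrite gE det_E x0 y0 !expr0n mulr0 subr0 eqxx.
  by exists g; rewrite // /f gE !mxE.
rewrite cardsC1 card_prod card_Fp //.
by case: ell (prime_gt0 ell_prime) => // l _; rewrite mulnS mulnC /= [RHS]mulnS.
Qed.

Lemma scalarGL_sub : scalarGL ell \subset Cns eps.
Proof.
apply/subsetP=> g; rewrite inE => /is_scalar_mxP[a ga]; apply/CnsP.
by exists a, 0; rewrite ga scalar_mx22 mulr0.
Qed.

(** A scalar matrix is given by its nonzero diagonal entry. *)
Lemma card_scalarGL : #|scalarGL ell| = ell.-1.
Proof.
pose f g := GLval g 0 0 : F.
have f_inj : {in scalarGL ell &, injective f}.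
  move=> g h; rewrite !inE => /is_scalar_mxP[a ga] /is_scalar_mxP[b hb].
  by rewrite /f ga hb !mxE /= => ab; apply: GL_inj; rewrite ga hb [a]ab.
rewrite -(card_in_imset f_inj).
have -> : f @: scalarGL ell = [set~ 0].
  apply/setP=> x; rewrite !inE; apply/imsetP/idP=> [[g]|nx].
    rewrite inE => /is_scalar_mxP[a ga]; rewrite /f ga mxE /= mulr1n => ->.
    apply: contraTneq (GL_det g) => a0.
    by rewrite ga a0 scalar_mx22 det_mx22 !mulr0 subrr eqxx.
  have [|g gE] := @GL_exists x%:M; first by rewrite det_scalar expf_neq0.
  by exists g; rewrite /f ?inE gE ?scalar_mx_is_scalar // mxE.
by rewrite cardsC1 card_Fp.
Qed.

Lemma two_neq0 : 2%:R != 0 :> F.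
Proof.
rewrite -(dvdn_pcharf (pchar_Fp ell_prime)); apply: contraL ell_odd.
by rewrite dvdn_prime2 // => /eqP ->.
Qed.

Lemma gamma_notin : gammaGL ell \notin Cns eps.
Proof.
apply/CnsP=> -[x [y]]; rewrite gammaE => /mx22_eqP[<- _ _ /eqP].
by rewrite -subr_eq0 -opprD oppr_eq0 -mulr2n (negPf two_neq0).
Qed.

Lemma gamma_conj c x y : GLval c = E x y -> GLval (c ^ gammaGL ell)%g = E x (- y).
Proof.
move=> cE; rewrite conjgE gammaV !GL_MxE gammaE cE !mul_mx22.
by apply/mx22_eqP; split; ring.
Qed.


Local Notation w_mx := (mx22 0 eps 1 0 : 'M[F]_2).

(** The matrix w plays the role of a square root of eps in F_{ell^2}. *)
Lemma w_exists : exists2 w : GL, w \in Cns eps & GLval w = w_mx.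
Proof.
have [|w Cw wE] := @Cns_exists 0 1; first by rewrite xpair_eqE oner_eq0 andbF.
by exists w => //; rewrite wE mulr1.
Qed.

Lemma scalarGL_central z n : z \in scalarGL ell -> (z * n = n * z)%g.
Proof.
rewrite inE => /is_scalar_mxP[a za]; apply: GL_inj.
by rewrite !GL_MxE za scalar_mxC.
Qed.

(** In the field F + F w the only square roots of eps are w and -w. *)
Lemma sqrt_eps x y : E x y *m E x y = E eps 0 -> x = 0 /\ (y = 1 \/ y = -1).
Proof.
rewrite mul_E => /E_inj[x2 xy0].
have {xy0} /eqP : (x * y) *+ 2 = 0 by rewrite mulr2n {2}mulrC.
rewrite -mulr_natr mulf_eq0 (negPf two_neq0) orbF mulf_eq0.
have [y0|ny] := eqVneq y 0.
  case: eps_nonsquare; exists x; rewrite -[LHS]x2 y0; ring.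
rewrite orbF => /eqP x0; move: x2; rewrite x0 => y2; split=> //.
have {y2} /eqP : eps * (y ^+ 2 - 1) = 0 by rewrite mulrBr mulr1 -{2}y2; ring.
have eps_neq0 : eps != 0 by rewrite -unitfE.
rewrite mulf_eq0 (negPf eps_neq0) subr_eq0 sqrf_eq1 /= => /orP[] /eqP ->.
  by left.
by right.
Qed.

(** A normalizing n sends w to another square root of eps, hence to w or -w;
    comparing entries in w n = n (w ^ n), n lies in C in the first case and in
    gamma C in the second. *)
Lemma Cns_norm_sub (n : GL) : n \in 'N(Cns eps)%g -> n \in Cns_plus eps.
Proof.
move=> Nn; have [w Cw wE] := w_exists.
have := memJ_norm w Nn; rewrite Cw => /CnsP[x [y vE]].
have w2E : GLval (w ^+ 2)%g = E eps 0.
  rewrite expgS expg1 GL_MxE wE mul_mx22; apply/mx22_eqP; split; ring.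
have Zw2 : (w ^+ 2)%g \in scalarGL ell.
  by rewrite inE w2E mulr0 -scalar_mx22 scalar_mx_is_scalar.
have v2E : ((w ^ n) ^+ 2 = w ^+ 2)%g.
  by rewrite -conjXg conjgE (scalarGL_central n Zw2) mulKg.
have := congr1 (@GLval _ _) v2E.
rewrite w2E expgS expg1 GL_MxE vE => /sqrt_eps[x0 y1].
have eqn := congr1 (@GLval _ _) (conjgC w n).
rewrite (GL_MxE w) (GL_MxE n) wE vE [GLval n]mx22_eta !mul_mx22 in eqn.
have nE := mx22_eta (GLval n).
move: (GLval n 0 0) (GLval n 0 1) (GLval n 1 0) (GLval n 1 1) nE eqn => a b c d nE.
rewrite x0; case/mx22_eqP.
rewrite !(mul0r, mulr0, add0r, addr0, mul1r) => e1 e2 e3 e4.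
rewrite inE; apply/orP; case: y1 => y1; rewrite y1 in e1 e2 e3 e4.
  left; apply/CnsP; exists a, c; rewrite nE; apply/mx22_eqP; split=> //.
    by rewrite e4; ring.
  by rewrite e3; ring.
right; rewrite mem_lcoset gammaV; apply/CnsP; exists a, (- c).
rewrite GL_MxE gammaE nE mul_mx22; apply/mx22_eqP; split; try ring.
  by rewrite e4; ring.
by rewrite e3; ring.
Qed.

Section CyclicCartan.
Variable delta : GL.
Hypothesis delta_gen : generator (Cns eps) delta.

Let CnsE : Cns eps = <[delta]>%g.
Proof. exact/eqP. Qed.

Lemma Cns_cycle c : (c \in Cns eps) = (c \in <[delta]>%g).
Proof. by rewrite CnsE. Qed.

Lemma Cns_X c k : c \in Cns eps -> (c ^+ k)%g \in Cns eps.
Proof. by rewrite !Cns_cycle => /(groupX k). Qed.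

Let ell_gt0 := prime_gt0 ell_prime.

Lemma exp_ell x : x ^+ ell = x.
Proof. by rewrite -[RHS]expf_card card_Fp. Qed.

Lemma scalar_exp_ell x : (x%:M : 'M[F]_2) ^+ ell = x%:M.
Proof. by rewrite -{2}(exp_ell x); exact/esym/(rmorphXn (@scalar_mx F 2)). Qed.

Lemma E_lin x y : E x y = x%:M + y *: w_mx.
Proof.
by rewrite [RHS]mx22_eta; apply/mx22_eqP; split; rewrite !mxE /=; ring.
Qed.

Lemma w_mx_sqr : w_mx ^+ 2 = eps%:M.
Proof.
rewrite expr2 -[LHS]/(w_mx *m w_mx) mul_mx22 scalar_mx22.
by apply/mx22_eqP; split; ring.
Qed.

(** The power w^ell squares to eps^ell = eps, so it is w or -w. If it were w,
    then w would have order dividing ell - 1 in the cyclic group C, and would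
    be scalar. *)
Lemma w_exp_ell : w_mx ^+ ell = - w_mx.
Proof.
have [w Cw wE] := w_exists.
have Cw' : w \in <[delta]>%g by rewrite -CnsE.
have [x [y vE]] := CnsP _ (Cns_X ell Cw).
have : E x y *m E x y = E eps 0.
  rewrite -vE GL_X wE -[LHS]expr2 -exprM mulnC exprM w_mx_sqr.
  by rewrite scalar_exp_ell mulr0 scalar_mx22.
move=> /sqrt_eps[x0 y1]; rewrite x0 in vE.
case: y1 => y1; rewrite y1 in vE; last first.
  rewrite -wE -GL_X vE wE [RHS]mx22_eta; apply/mx22_eqP.
  by split; rewrite !mxE /=; ring.
have sZC : scalarGL_group ell \subset <[delta]>%G by rewrite /= -CnsE scalarGL_sub.
have : w \in scalarGL_group ell.
  rewrite (mem_cyclic_sub (cycle_cyclic delta) sZC Cw') card_scalarGL //.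
  rewrite -(inj_eq (mulgI w)) -expgS prednK // mulg1; apply/eqP/GL_inj.
  by rewrite vE wE mulr1.
rewrite inE => /is_scalar_mxP[a]; rewrite wE scalar_mx22 => /mx22_eqP[_ _ /eqP].
by rewrite oner_eq0.
Qed.

(** By Frobenius in characteristic ell, (x + y w)^ell = x + y w^ell = x - y w,
    which is the conjugate by gamma. *)
Lemma Cns_pow c : c \in Cns eps -> (c ^ gammaGL ell = c ^+ ell)%g.
Proof.
case/CnsP=> x [y cE]; apply: GL_inj; rewrite (gamma_conj cE) GL_X cE !E_lin.
have pM : ell \in [pchar 'M[F]_2].
  by rewrite inE ell_prime -(rmorph_nat (@scalar_mx F 2)) pchar_Fp_0 // rmorph0 eqxx.
rewrite -(pFrobenius_autE pM) pFrobenius_autD_comm; last exact/esym/scalar_mxC.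
rewrite !pFrobenius_autE scalar_exp_ell exprZn exp_ell w_exp_ell.
by rewrite scalerN scaleNr.
Qed.

(** The norm c (c ^ gamma) of x + y w is x^2 - eps y^2. *)
Lemma Cns_norm_pow c : c \in Cns eps ->
  GLval (c ^+ ell.+1)%g = (\det (GLval c))%:M.
Proof.
move=> Cc; have /CnsP[x [y cE]] := Cc.
rewrite expgS GL_MxE -(Cns_pow Cc) (gamma_conj cE) cE det_E mul_E scalar_mx22.
by apply/mx22_eqP; split; ring.
Qed.

Lemma Cns_group_set : group_set (Cns eps).
Proof. by rewrite CnsE groupP. Qed.

Definition Cns_group := Group Cns_group_set.

Lemma Cns_frobenius_twist :
  frobenius_twist Cns_group (scalarGL_group ell) (gammaGL ell) ell.
Proof.
split=> //=.
- exact: prime_gt1.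
- by rewrite CnsE cycle_cyclic.
- exact: card_Cns.
- exact: scalarGL_sub.
- exact: card_scalarGL.
- exact: gamma2.
- exact: gamma_notin.
- by move=> c /Cns_pow.
Qed.

Lemma Cns_det_norm : {in Cns eps &, forall c c' : GL,
  \det (GLval c) = \det (GLval c') <-> (c ^+ ell.+1 = c' ^+ ell.+1)%g}.
Proof.
move=> c c' Cc Cc'; split=> [eqdet | /(congr1 (@GLval _ _))].
  by apply: GL_inj; rewrite !Cns_norm_pow // eqdet.
rewrite !Cns_norm_pow // => /matrixP/(_ 0 0).
by rewrite !mxE.
Qed.

End CyclicCartan.

Lemma detGL_M (g h : GL) :
  \det (GLval (g * h)%g) = \det (GLval g) * \det (GLval h).
Proof. by rewrite GL_MxE det_mulmx. Qed.

Lemma det_gamma : \det (GLval (gammaGL ell)) = -1.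
Proof. by rewrite gammaE det_mx22; ring. Qed.

Lemma minus1E : GLval (minus1 ell) = (-1)%:M.
Proof. by rewrite raddfN. Qed.

Lemma minus1_scalar : minus1 ell \in scalarGL ell.
Proof. by rewrite inE minus1E scalar_mx_is_scalar. Qed.

Lemma minus1_sqr : (minus1 ell * minus1 ell = 1)%g.
Proof.
by apply: GL_inj; rewrite GL_MxE minus1E -scalar_mxM mulrNN mulr1.
Qed.

Lemma minus1_neq1 : minus1 ell != 1%g.
Proof.
apply/eqP=> /(congr1 (@GLval _ _)); rewrite minus1E GL_1E => /matrixP/(_ 0 0).
rewrite !mxE /= => /eqP.
by rewrite -subr_eq0 -opprD oppr_eq0 -mulr2n (negPf two_neq0).
Qed.

End Cartan.

(** * The classification for GL_2 *)

Theorem corollary3p17 (ell : nat) (ell_prime : prime ell) (ell_odd : odd ell)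
    (eps : 'F_ell) (eps_unit : eps \is a GRing.unit)
    (eps_nonsquare : ~ exists a : 'F_ell, eps = a ^+ 2)
    (delta : {'GL_2['F_ell]}) (delta_gen : generator (Cns eps) delta) :
  [/\ (forall H : {group {'GL_2['F_ell]}},
         H \subset Cns eps -> ~~ (H \subset scalarGL ell) ->
         [/\ G1 H \subset Cns_plus eps,
             is_dihedral (imPGL (G1 H)),
             H = G1 H :&: Cns eps :> {set {'GL_2['F_ell]}}
           & detset H = opp_detset (G1 H :\: H)]),
      (forall H : {group {'GL_2['F_ell]}},
         H \subset Cns eps -> ~~ (H \subset scalarGL ell) ->
         detset H = detset (H :&: scalarGL ell) -> minus1 ell \in H ->
         [/\ G2 delta H \subset Cns_plus eps,
             is_dihedral (imPGL (G2 delta H)),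
             H = G2 delta H :&: Cns eps :> {set {'GL_2['F_ell]}}
           & [disjoint detset H & opp_detset (G2 delta H :\: H)]]),
      (forall G : {group {'GL_2['F_ell]}}, G \in dihedral_nonsplit eps ->
         exists (g : {'GL_2['F_ell]}) (H : {group {'GL_2['F_ell]}}),
           [/\ H \subset Cns eps, ~~ (H \subset scalarGL ell)
             & (G :^ g)%g = G1 H \/
               [/\ detset H = detset (H :&: scalarGL ell), minus1 ell \in H
                 & (G :^ g)%g = G2 delta H]])
    & (#|conj_classes (dihedral_nonsplit eps)|)%:Z
        = (tau (ell ^ 2 - 1))%:Z - (tau (ell - 1))%:Z
          + (tau ((ell ^ 2 - 1) %/ 4))%:Z - (tau ((ell - 1) %/ 2))%:Z].
Proof.
have T := Cns_frobenius_twist ell_prime ell_odd eps_unit eps_nonsquare delta_gen.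
have defC : Cns_group delta_gen = <[delta]>%g :> {set _} := eqP delta_gen.
have centZ (z x : {'GL_2['F_ell]}) : z \in scalarGL_group ell -> commute z x.
  exact: scalarGL_central.
have sNC : ('N(Cns_group delta_gen)
    \subset Cns_group delta_gen :|: gammaGL ell *: Cns_group delta_gen)%g.
  by apply/subsetP=> n; apply: Cns_norm_sub.
pose det (x : {'GL_2['F_ell]}) := \det (GLval x).
have det1 : det 1%g = 1 by rewrite /det GL_1E det1.
have detM : {morph det : x y / (x * y)%g >-> x * y} by move=> x y; apply: detGL_M.
have detg : det (gammaGL ell) = -1 := det_gamma ell.
have detN := Cns_det_norm ell_prime ell_odd eps_unit eps_nonsquare delta_gen.
have Z1 := minus1_scalar ell.
have m1s := minus1_sqr ell.
have m1n := minus1_neq1 ell_prime ell_odd.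
have E2 (H : {group {'GL_2['F_ell]}}) :
  ext2 (scalarGL_group ell) (gammaGL ell) delta H = G2 delta H by [].
split.
- exact: (ext1_props T detM detg).
- move=> H sHC nHZ detH Hm1.
  have := @ext2_props {'GL_2['F_ell]} (Cns_group delta_gen) (scalarGL_group ell)
    (gammaGL ell) delta (minus1 ell) ell _ det T defC detM detg detN Z1 m1s m1n
    H sHC nHZ detH Hm1.
  by rewrite E2.
- move=> G /(@dihedrals_classify {'GL_2['F_ell]} (Cns_group delta_gen)
    (scalarGL_group ell) (gammaGL ell) delta (minus1 ell) ell _ det T defC centZ
    sNC detN Z1 m1s m1n) [g [H]].
  by rewrite E2; exists g, H.
exact: (card_classes T defC centZ sNC det1 detM detg detN Z1 m1s m1n).
Qed.
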